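(* Let $\mathcal{S}$ be a unipotent numerical monoid in $G$ and let $\mathcal{I}$ be a subset of $\mathcal{S}$. Then the following statements are equivalent: (1) $\mathcal{S}\setminus\mathcal{I}$ is a lower order ideal of the poset $(\mathcal{S},\leq_{\mathcal{S},l})$; (2) $\mathcal{I}$ is a right ideal of $\mathcal{S}$.
   Context: Setting: $n$ is a positive integer, $\mathbf{U}(n,\mathbb{C})$ is the group of upper triangular unipotent $n\times n$ complex matrices, and $G$ is a (Zariski) closed subgroup of it. $G_{\mathbb{Z}}$ is the group of matrices in $G$ with integer entries, and $G(\mathbb{N})$ is the monoid of matrices in $G_{\mathbb{Z}}$ all of whose entries lie in $\mathbb{N}=\{0,1,2,\dots\}$. Standing assumptions: the monoid $G(\mathbb{N})$ is finitely generated and $G_{\mathbb{Z}}$ is its group completion. A unipotent numerical monoid in $G$ is a finitely generated submonoid $\mathcal{S}\subseteq G(\mathbb{N})$ (containing the identity matrix) such that $G(\mathbb{N})\setminus\mathcal{S}$ is finite. The partial order $\leq_{\mathcal{S},l}$ on $G_{\mathbb{Z}}$ is $A\leq_{\mathcal{S},l}B\iff A^{-1}B\in\mathcal{S}$. A lower order ideal of a poset $(P,\leq)$ is a subset $L\subseteq P$ such that $y\in L$, $x\in P$, $x\leq y$ imply $x\in L$. A right ideal of $\mathcal{S}$ is a subset $\mathcal{I}\subseteq\mathcal{S}$ with $\mathcal{I}\mathcal{S}:=\{XY\mid X\in\mathcal{I},Y\in\mathcal{S}\}\subseteq\mathcal{I}$. *)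

(* Defs.v *)
From mathcomp Require Import all_boot all_order all_algebra.
From mathcomp Require Import classical_sets cardinality reals complex.
From mathcomp Require Import mpoly.

Set Implicit Arguments.
Unset Strict Implicit.
Unset Printing Implicit Defensive.

Import GRing.Theory.

Local Open Scope classical_set_scope.
Local Open Scope ring_scope.

Definition unipotent_upper (K : fieldType) (n : nat) : set 'M[K]_n :=
  [set A | (forall i, A i i = 1) /\
           (forall i j : 'I_n, (j < i)%N -> A i j = 0)].

Definition is_submonoid (K : fieldType) (n : nat) (M : set 'M[K]_n) : Prop :=
  M 1%:M /\ (forall A B, M A -> M B -> M (A *m B)).

(* [invmx A] is the inverse only for invertible [A], hence the [unitmx]
   requirement. *)
Definition is_subgroup (K : fieldType) (n : nat) (G : set 'M[K]_n) : Prop :=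
  [/\ is_submonoid G,
      forall A, G A -> A \in unitmx &
      forall A, G A -> G (invmx A)].

Definition zariski_closed (K : fieldType) (n : nat) (X : set 'M[K]_n) : Prop :=
  exists P : set {mpoly K[n * n]},
    X = [set A | forall p, P p -> p.@[mxvec A 0] = 0].

(* U(n, K) is itself Zariski closed among all n x n matrices, so being closed in
   U(n, K) and being closed in the space of matrices agree for subsets of it. *)
Definition closed_subgroup_of_U (K : fieldType) (n : nat) (G : set 'M[K]_n) :
    Prop :=
  [/\ G `<=` @unipotent_upper K n, is_subgroup G & zariski_closed G].

Definition integer_points (K : fieldType) (n : nat) (G : set 'M[K]_n) :
    set 'M[K]_n :=
  [set A | G A /\ forall i j, exists m : int, A i j = m%:~R].

Definition nat_points (K : fieldType) (n : nat) (G : set 'M[K]_n) :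
    set 'M[K]_n :=
  [set A | integer_points G A /\ forall i j, exists m : nat, A i j = m%:R].

Definition finitely_generated (K : fieldType) (n : nat) (M : set 'M[K]_n) :
    Prop :=
  exists gens : seq 'M[K]_n,
    M = [set A | exists2 w : seq 'M[K]_n,
           {subset w <= gens} & A = \big[mulmx/1%:M]_(B <- w) B].

(* The values of [f] outside of [M] are irrelevant. *)
Definition monoid_hom_on (K : fieldType) (n : nat) (M : set 'M[K]_n)
    (H : groupType) (f : 'M[K]_n -> H) : Prop :=
  f 1%:M = 1%g /\ (forall A B, M A -> M B -> f (A *m B) = (f A * f B)%g).

(* Universal property: every monoid homomorphism from [M] to a group extends
   uniquely along the inclusion of [M] in [Gam] to a group homomorphism. *)
Definition is_group_completion (K : fieldType) (n : nat)
    (M Gam : set 'M[K]_n) : Prop :=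
  [/\ is_submonoid M, is_subgroup Gam, M `<=` Gam &
      forall (H : groupType) (f : 'M[K]_n -> H), monoid_hom_on M f ->
        exists g : 'M[K]_n -> H,
          [/\ monoid_hom_on Gam g,
              forall A, M A -> g A = f A &
              forall g' : 'M[K]_n -> H, monoid_hom_on Gam g' ->
                (forall A, M A -> g' A = f A) ->
                forall A, Gam A -> g' A = g A]].

Definition unipotent_numerical_monoid (K : fieldType) (n : nat)
    (G S : set 'M[K]_n) : Prop :=
  [/\ S `<=` nat_points G, is_submonoid S, finitely_generated S &
      finite_set (nat_points G `\` S)].

(* The intended domain is the group of integer points, where all matrices are
   invertible. *)
Definition le_left (K : fieldType) (n : nat) (S : set 'M[K]_n)
    (A B : 'M[K]_n) : Prop :=
  S (invmx A *m B).

Definition lower_order_ideal (T : Type) (P : set T) (le : T -> T -> Prop)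
    (L : set T) : Prop :=
  L `<=` P /\ (forall x y, L y -> P x -> le x y -> L x).

Definition right_ideal (K : fieldType) (n : nat) (S I : set 'M[K]_n) : Prop :=
  I `<=` S /\ [set X *m Y | X in I & Y in S] `<=` I.

(* Main.v *)
Require Import Defs.
From mathcomp Require Import all_boot all_order all_algebra.
From mathcomp Require Import classical_sets cardinality reals complex.
From mathcomp Require Import boolp.

Local Open Scope classical_set_scope.
Local Open Scope ring_scope.

(** For [X] in [S], which is invertible, the matrices above [X] are exactly the products [X *m Y]
    with [Y] in [S]. So a right ideal of [S] is an upward closed subset of [S], and these are the
    complements in [S] of the downward closed ones. *)

Lemma lower_order_ideal_setD (K : fieldType) (n : nat) (S I : set 'M[K]_n) :
  (forall A B, S A -> S B -> S (A *m B)) ->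
  (forall A, S A -> A \in unitmx) ->
  I `<=` S ->
  lower_order_ideal S (le_left S) (S `\` I) <-> right_ideal S I.
Proof.
move=> mulS unitS IS; split=> [[_ lowI] | [_ rightI]].
  split=> // _ [X IX [Y SY <-]]; apply: contrapT => nIXY.
  (* [X] lies below [X *m Y], so [X *m Y] outside [I] would force [X] outside [I]. *)
  have SX := IS _ IX; have [_] : (S `\` I) X; last exact.
  apply: (lowI _ (X *m Y)) => //; first by split=> //; exact: mulS.
  by rewrite /le_left mulKmx ?unitS.
split=> [A []// | X Y [_ nIY] SX leXY]; split=> // IX; apply: nIY.
(* [leXY] says that the right factor [invmx X *m Y] of [Y] lies in [S]. *)
by apply: rightI; exists X => //; exists (invmx X *m Y); rewrite ?mulKVmx ?unitS.
Qed.

Theorem theorem5p4 (R : realType) (n : nat) (G S I : set 'M[complex R]_n) :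
  (0 < n)%N ->
  closed_subgroup_of_U G ->
  finitely_generated (nat_points G) ->
  is_group_completion (nat_points G) (integer_points G) ->
  unipotent_numerical_monoid G S ->
  I `<=` S ->
  (lower_order_ideal S (le_left S) (S `\` I) <-> right_ideal S I).
Proof.
move=> _ [_ [_ unitG _] _] _ _ [SG [_ mulS] _ _].
(* Elements of [S] are invertible because they lie in the group [G]. *)
apply: lower_order_ideal_setD => // A /SG [[GA _] _].
exact: unitG.
Qed.
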